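(* Let $k\ge 1$ and let $\sigma,\tau\in\mathcal{S}_k$ be strong-c-forest-Wilf equivalent. Then $\sigma(1)=\tau(1)$ or $\sigma(1)+\tau(1)=k+1$.
   Context: A forest on $[n]$ is an unordered rooted forest with $n$ vertices labeled bijectively by $1,\dots,n$; $F_n$ is the set of such forests. A consecutive instance of $\sigma\in\mathcal{S}_k$ in a labeled forest is a sequence of vertices $v_1,\dots,v_k$ such that $v_i$ is the parent of $v_{i+1}$ for $1\le i\le k-1$ and the labels of $v_1,\dots,v_k$ are in the same relative order as $\sigma(1),\dots,\sigma(k)$. Patterns $\sigma,\tau$ are strong-c-forest-Wilf equivalent if for all $n,m\ge 0$ the number of forests in $F_n$ with exactly $m$ consecutive instances of $\sigma$ equals the number of forests in $F_n$ with exactly $m$ consecutive instances of $\tau$. *)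

(* Defs.v *)
From HB Require Import structures.
From mathcomp Require Import all_boot all_fingroup.

Set Implicit Arguments.
Unset Strict Implicit.
Unset Printing Implicit Defensive.

(* An unordered rooted forest with vertex set [n] is encoded by its parent map
   ([None] on roots). Labels are the elements 0, ..., n-1 of 'I_n instead of
   1, ..., n, and permutations in 'S_k act on {0, ..., k-1}. *)

Definition parent_map (n : nat) := {ffun 'I_n -> option 'I_n}.

Definition child_of n (p : parent_map n) : rel 'I_n :=
  fun v u => p v == Some u.

(* No vertex is a proper ancestor of itself. *)
Definition is_forest n (p : parent_map n) : bool :=
  [forall v, forall u, child_of p v u ==> ~~ connect (child_of p) u v].

Definition forests (n : nat) : {set parent_map n} := [set p | is_forest p].

Definition consecutive_instance n k (p : parent_map n) (s : 'S_k)
    (v : k.-tuple 'I_n) : bool :=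
  [forall i : 'I_k, forall j : 'I_k,
     (j == i.+1 :> nat) ==> child_of p (tnth v j) (tnth v i)] &&
  [forall i : 'I_k, forall j : 'I_k,
     (tnth v i < tnth v j) == (s i < s j)].

Definition num_instances n k (s : 'S_k) (p : parent_map n) : nat :=
  #|[set v : k.-tuple 'I_n | consecutive_instance p s v]|.

Definition strong_c_forest_Wilf_equivalent k (s t : 'S_k) : Prop :=
  forall n m : nat,
    #|[set p in forests n | num_instances s p == m]| =
    #|[set p in forests n | num_instances t p == m]|.

(* Main.v *)
Require Import Defs.
From HB Require Import structures.
From mathcomp Require Import all_boot all_fingroup.
From mathcomp Require Import zify.

(** Compare second moments: sum over forests on [n] of the squared number of
    instances counts triples (forest, instance u, instance v).  Disjoint pairs
    (u, v) contribute equally for all patterns.  If u and v meet, their union is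
    a subtree, and the number of forests containing a given subtree depends only
    on its number of vertices: replace it by a star with the same root.  Hence,
    by induction on n, the number L(n) of pairs (u, v) that meet, fit in some
    forest and cover [n] is determined by the distribution.

    For n = 2k-1 such a pair shares exactly one vertex, which must be the root of
    u or of v.  The pairs sharing the root of v are counted by v alone, since the
    support of u is then the complement of that of v plus this root; so their
    number does not depend on the pattern.  By inclusion-exclusion L(2k-1)
    determines the number of pairs with a common root.  With a = sigma(1) - 1
    this root has label 2a+1, so that number is C(2a, a) C(2(k-1-a), k-1-a),
    which is strictly decreasing in a up to (k-1)/2 because the central binomial
    coefficients are strictly log-convex. *)

Set Implicit Arguments.
Unset Strict Implicit.
Unset Printing Implicit Defensive.

(** * Ranked forests and chains *)

Lemma is_forestP n (p : parent_map n) :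
  reflect (exists h : 'I_n -> nat, forall x y, p x = Some y -> h y < h x)
          (is_forest p).
Proof.
apply: (iffP idP) => [/forallP fp | [h hp]].
  (* The rank is the number of ancestors, the vertex itself included. *)
  exists (fun x => #|[set y | connect (child_of p) x y]|) => x y pxy.
  have exy : child_of p x y by apply/eqP.
  apply/proper_card/properP; split.
    by apply/subsetP=> z; rewrite !inE; apply/connect_trans/connect1.
  exists x; rewrite !inE ?connect0 //.
  by move/forallP: (fp x) => /(_ y) /implyP; apply.
apply/forallP=> x; apply/forallP=> y; apply/implyP=> /eqP /hp hxy.
apply/negP=> /connectP [s ps xl].
have : h x <= h y.
  rewrite {hxy}xl; elim: s y ps => //= z s IHs y /andP[/eqP /hp hzy /IHs].
  by move=> le; apply: leq_trans le (ltnW hzy).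
by rewrite leqNgt hxy.
Qed.

(** The two halves of [consecutive_instance] are separated because [chain] does not see the pattern
    and [order_type] does not see the forest. *)
Definition chain n k (p : parent_map n) (u : k.-tuple 'I_n) : bool :=
  [forall i : 'I_k, forall j : 'I_k,
     (j == i.+1 :> nat) ==> child_of p (tnth u j) (tnth u i)].

Definition order_type n k (s : 'S_k) (u : k.-tuple 'I_n) : bool :=
  [forall i : 'I_k, forall j : 'I_k, (tnth u i < tnth u j) == (s i < s j)].

Lemma chainP n k (p : parent_map n) (u : k.-tuple 'I_n) :
  reflect (forall i j : 'I_k, j = i.+1 :> nat -> p (tnth u j) = Some (tnth u i))
          (chain p u).
Proof.
apply: (iffP forallP) => [H i j /eqP eij | H i].
  by have /forallP/(_ j)/implyP/(_ eij)/eqP := H i.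
by apply/forallP=> j; apply/implyP=> /eqP/H/eqP.
Qed.

Lemma order_typeP n k (s : 'S_k) (u : k.-tuple 'I_n) :
  reflect (forall i j, (tnth u i < tnth u j) = (s i < s j)) (order_type s u).
Proof.
apply: (iffP forallP) => [H i j | H i]; first by have /forallP/(_ j)/eqP := H i.
by apply/forallP=> j; apply/eqP.
Qed.

Lemma order_type_inj n k (s : 'S_k) (u : k.-tuple 'I_n) :
  order_type s u -> injective (tnth u).
Proof.
move=> /order_typeP su i j eij; apply: (@perm_inj _ s); apply: val_inj => /=.
have := su i j; have := su j i; rewrite eij ltnn; lia.
Qed.

Lemma inj_tuple_uniq (T : eqType) k (u : k.-tuple T) :
  injective (tnth u) -> uniq u.
Proof.
by move=> ui; rewrite -[X in uniq X]map_tnth_enum map_inj_uniq ?enum_uniq.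
Qed.

(** * Exchanging a subtree for another one on the same vertices *)

Definition graft n (T : {set 'I_n}) (p1 p : parent_map n) : parent_map n :=
  [ffun x => if x \in T then p1 x else p x].

(* Ranks are refined lexicographically: all of [T] is squeezed between [r] and
   the vertices hanging below [T]. *)
Lemma graft_forest n (T : {set 'I_n}) r (p1 p : parent_map n) :
    r \notin T -> is_forest p -> is_forest p1 ->
    {in T, forall x, exists2 y, p x = Some y & y \in r |: T} ->
    {in T, forall x, exists2 y, p1 x = Some y & y \in r |: T} ->
  is_forest (graft T p1 p).
Proof.
move=> rT /is_forestP[h hp] /is_forestP[h1 hp1] pT p1T; apply/is_forestP.
have below x : x \in T -> h r < h x.
  have [m] := ubnP (h x); elim: m x => // m IHm x hx xT.
  have [y pxy yS] := pT x xT; have hyx := hp _ _ pxy.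
  move: yS; rewrite in_setU1 => /predU1P[<- // | yT].
  by apply: ltn_trans (hyx); apply: IHm => //; apply: leq_trans hyx hx.
pose C := (\max_x h1 x).+2; have C1 x : h1 x + 1 < C.
  by rewrite /C addn1 !ltnS; apply: leq_bigmax.
move: C C1 => C C1.
(* The summand 1 keeps [T] above [C * h r], and [h1 x + 1 < C] keeps it below [C * (h r).+1]. *)
exists (fun x => if x \in T then C * h r + h1 x + 1 else C * h x) => x y.
rewrite ffunE; case: ifP => xT pxy.
  have [z] := p1T x xT; rewrite pxy => -[<-]; rewrite in_setU1.
  case/predU1P=> [->|yT]; first by rewrite (negPf rT); lia.
  by rewrite yT; have := hp1 _ _ pxy; lia.
have hyx := hp _ _ pxy; case: ifP => yT; last by (rewrite ltn_pmul2l //; have := C1 x; lia).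
by have := below y yT; have := C1 y; nia.
Qed.

Definition agreeing n (T : {set 'I_n}) (p0 : parent_map n) :=
  [set p in forests n | [forall x in T, p x == p0 x]].

Lemma agreeingP n (T : {set 'I_n}) (p0 p : parent_map n) :
  reflect (is_forest p /\ {in T, p =1 p0}) (p \in agreeing T p0).
Proof.
rewrite !inE; apply: (iffP andP) => -[fp H]; split=> //.
  by move=> x xT; move/forall_inP: H => /(_ x xT) /eqP.
by apply/forall_inP=> x xT; rewrite H.
Qed.

(** Grafting loses no information: the parents it overwrites on [T] were prescribed by [p0]. *)
Lemma leq_agreeing n (T : {set 'I_n}) r (p0 p1 : parent_map n) :
    r \notin T -> is_forest p1 ->
    {in T, forall x, exists2 y, p0 x = Some y & y \in r |: T} ->
    {in T, forall x, exists2 y, p1 x = Some y & y \in r |: T} ->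
  #|agreeing T p0| <= #|agreeing T p1|.
Proof.
move=> rT f1 p0T p1T; rewrite -(card_in_imset (f := graft T p1)).
  apply/subset_leq_card/subsetP=> _ /imsetP[p /agreeingP[fp pT] ->].
  apply/agreeingP; split; last by move=> x xT; rewrite ffunE xT.
  by apply: (graft_forest rT) => // x xT; rewrite pT //; apply: p0T.
move=> p q /agreeingP[_ pT] /agreeingP[_ qT] /ffunP epq; apply/ffunP=> x.
case: (boolP (x \in T)) => xT; first by rewrite pT ?qT.
by have := epq x; rewrite !ffunE (negPf xT).
Qed.

Definition star n (T : {set 'I_n}) r : parent_map n :=
  [ffun x => if x \in T then Some r else None].

Lemma star_forest n (T : {set 'I_n}) r : r \notin T -> is_forest (star T r).
Proof.
move=> rT; apply/is_forestP; exists (fun x => x \in T) => x y.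
by rewrite ffunE; case: ifP => // _ [<-]; rewrite (negPf rT).
Qed.

Lemma card_agreeing_star n (T : {set 'I_n}) r (p0 : parent_map n) :
    r \notin T -> is_forest p0 ->
    {in T, forall x, exists2 y, p0 x = Some y & y \in r |: T} ->
  #|agreeing T p0| = #|agreeing T (star T r)|.
Proof.
move=> rT f0 p0T; have sT: {in T, forall x, exists2 y,
    star T r x = Some y & y \in r |: T}.
  by move=> x xT; exists r; rewrite ?ffunE ?xT // setU11.
apply/eqP; rewrite eqn_leq; apply/andP; split.
  by apply: leq_agreeing sT => //; apply: star_forest.
exact: leq_agreeing rT f0 sT p0T.
Qed.

(** * Relabelling *)

Lemma perm_extend (T : finType) (s t : seq T) :
  uniq s -> uniq t -> size s = size t -> exists pi : {perm T}, map pi s = t.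
Proof.
move=> us ut est; case: s => [|x0 s'] in us est *.
  by exists 1%g; case: t est {ut}.
(* Each list followed by the elements it misses enumerates [T]; the permutation matches equal
   positions of the two enumerations. *)
set s := x0 :: s' in us est *; pose co (a : seq T) := [seq x <- enum T | x \notin a].
have cop a : uniq a -> perm_eq (a ++ co a) (enum T).
  move=> ua; apply: uniq_perm; rewrite ?enum_uniq ?cat_uniq ?ua ?filter_uniq ?enum_uniq //=.
    rewrite andbT; apply/hasPn=> x; by rewrite mem_filter => /andP[].
    by rewrite -enumT enum_uniq.
  by move=> x; rewrite mem_cat mem_filter mem_enum andbT orbN.
have ps := cop s us; have pt := cop t ut.
pose f x := nth x0 (t ++ co t) (index x (s ++ co s)).
have in_s x : x \in s ++ co s by rewrite (perm_mem ps) mem_enum.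
have szE : size (t ++ co t) = size (s ++ co s).
  by rewrite (perm_size ps) (perm_size pt).
have finj : injective f.
  move=> x y /eqP; rewrite nth_uniq ?szE ?index_mem //.
    by move/eqP/index_inj; apply.
  by rewrite (perm_uniq pt) enum_uniq.
exists (perm finj); apply: (@eq_from_nth _ x0); first by rewrite size_map.
move=> i; rewrite size_map => lis; rewrite (nth_map x0) // permE /f index_cat.
by rewrite mem_nth // index_uniq // nth_cat -est lis.
Qed.

Definition relabel n (pi : 'S_n) (p : parent_map n) : parent_map n :=
  [ffun x => omap pi (p ((pi^-1)%g x))].

Lemma relabel_inj n (pi : 'S_n) : injective (relabel pi).
Proof.
move=> p q /ffunP epq; apply/ffunP=> x; have := epq (pi x).
by rewrite !ffunE permK; apply: inj_omap; apply: perm_inj.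
Qed.

Lemma relabel_forest n (pi : 'S_n) p : is_forest p -> is_forest (relabel pi p).
Proof.
case/is_forestP=> h hp; apply/is_forestP; exists (fun x => h ((pi^-1)%g x)) => x y.
by rewrite ffunE; case E: (p _) => [z|] //= [<-]; rewrite permK; apply: hp.
Qed.

Lemma relabelE n (pi : 'S_n) (p : parent_map n) x :
  relabel pi p (pi x) = omap pi (p x).
Proof. by rewrite ffunE permK. Qed.

(** A relabelling taking [r] to [r'] and [T] onto [T'] is an injection between the two sets. The
    hypotheses are symmetric, so equality follows. *)
Lemma leq_star n (T T' : {set 'I_n}) r r' :
    r \notin T -> r' \notin T' -> #|T| = #|T'| ->
  #|agreeing T (star T r)| <= #|agreeing T' (star T' r')|.
Proof.
move=> rT rT' eT.
have [||| pi [pir piT]] := @perm_extend _ (r :: enum T) (r' :: enum T').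
- by rewrite /= mem_enum rT enum_uniq.
- by rewrite /= mem_enum rT' enum_uniq.
- by rewrite /= -!cardE eT.
rewrite -(card_imset _ (@relabel_inj _ pi)).
apply/subset_leq_card/subsetP=> _ /imsetP[p /agreeingP[fp pT] ->].
apply/agreeingP; split; first exact: relabel_forest.
move=> x xT'; have: x \in map pi (enum T) by rewrite piT mem_enum.
case/mapP=> y; rewrite mem_enum => yT ex.
by rewrite ex relabelE pT // !ffunE yT -ex xT' /= pir.
Qed.

(** * Forests containing two chains *)

Definition containing n k (u v : k.-tuple 'I_n) :=
  [set p in forests n | chain p u && chain p v].

Lemma containingC n k (u v : k.-tuple 'I_n) : containing u v = containing v u.
Proof. by apply/setP=> p; rewrite !inE [chain p u && _]andbC. Qed.

Definition overlap n k (u v : k.-tuple 'I_n) : bool := has (mem v) u.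

Definition span n k (u v : k.-tuple 'I_n) : {set 'I_n} :=
  [set x in u] :|: [set x in v].

Lemma overlapC n k (u v : k.-tuple 'I_n) : overlap u v = overlap v u.
Proof. by rewrite /overlap has_sym. Qed.

Lemma spanC n k (u v : k.-tuple 'I_n) : span u v = span v u.
Proof. exact: setUC. Qed.

Lemma containingP n k (u v : k.-tuple 'I_n) p :
  reflect [/\ is_forest p, chain p u & chain p v] (p \in containing u v).
Proof. by rewrite !inE; apply: and3P. Qed.

(** From a common vertex both chains climb through the same parents until one of them reaches its
    first vertex, which then lies on the other. *)
Lemma chain_overlap n k (p : parent_map n) (u v : k.+1.-tuple 'I_n) :
    chain p u -> chain p v -> overlap u v ->
  tnth v ord0 \in u \/ tnth u ord0 \in v.
Proof.
move=> /chainP pu /chainP pv /hasP[x /tnthP[i ->{x}] /= /tnthP[j]].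
have [m] := ubnP (nat_of_ord i); elim: m i j => // m IHm i j im eij.
have [i0|i0] := posnP i.
  by right; rewrite (_ : ord0 = i) ?eij ?mem_tnth //; apply: val_inj.
have [j0|j0] := posnP j.
  by left; rewrite (_ : ord0 = j) -?eij ?mem_tnth //; apply: val_inj.
have pi : i.-1 < k.+1 by have := ltn_ord i; lia.
have pj : j.-1 < k.+1 by have := ltn_ord j; lia.
apply: (IHm (Ordinal pi) (Ordinal pj)) => /=; first by lia.
have := pu (Ordinal pi) i; have := pv (Ordinal pj) j.
by rewrite /= !prednK // eij => -> // /(_ erefl)[].
Qed.

Lemma chain_rank n k (p : parent_map n) (u : k.-tuple 'I_n) h (i j : 'I_k) :
    chain p u -> (forall x y, p x = Some y -> h y < h x) ->
  i < j -> h (tnth u i) < h (tnth u j).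
Proof.
move=> /chainP pu hp; case: j => j; elim: j => // j IHj lj /=.
rewrite ltnS leq_eqVlt => /predU1P[ij | ij].
  by apply/hp/pu => /=; rewrite ij.
have lj' := ltnW lj; apply: ltn_trans (IHj lj' ij) _.
exact/hp/(pu (Ordinal lj')).
Qed.

(** The parent [y] is chosen before the forest [q], so it is the same in all forests containing the
    chain. *)
Lemma chain_parent n k (p : parent_map n) (u : k.+1.-tuple 'I_n) x :
    x \in u -> x != tnth u ord0 ->
  exists2 y, y \in u & forall q, chain q u -> q x = Some y.
Proof.
case/tnthP=> i -> xi; have i0 : 0 < i.
  by rewrite lt0n; apply: contraNneq xi => i0; apply/eqP; congr tnth; apply: val_inj.
have pi : i.-1 < k.+1 by have := ltn_ord i; lia.
exists (tnth u (Ordinal pi)); first exact: mem_tnth.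
by move=> q /chainP; apply; rewrite /= prednK.
Qed.

(** When [v] starts on [u], the union is a tree rooted at the first vertex [r] of [u]. The chains
    fix the parents of all its other vertices and do not constrain the parent of [r]. *)
Lemma containing_agreeing n k (u v : k.+1.-tuple 'I_n) p0 :
    injective (tnth u) -> p0 \in containing u v -> tnth v ord0 \in u ->
  let r := tnth u ord0 in let T := span u v :\ r in
  containing u v = agreeing T p0 /\
  {in T, forall x, exists2 y, p0 x = Some y & y \in r |: T}.
Proof.
move=> ui /containingP[f0 pu pv] vu r T.
have rS : r \in span u v by rewrite !inE mem_tnth.
have par x : x \in T ->
    exists2 y, y \in span u v & forall q, chain q u -> chain q v -> q x = Some y.
  rewrite !inE => /andP[xr xS].
  have [xu | xu] := boolP (x \in u).
    have [y yu qy] := chain_parent p0 xu xr.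
    by exists y => [|q qu _]; rewrite ?inE ?yu ?qy.
  rewrite (negPf xu) /= in xS.
  have [|y yv qy] := chain_parent p0 xS; first by apply: contraNneq xu => ->.
  by exists y => [|q _ qv]; rewrite ?inE ?yv ?orbT ?qy.
have rT : r |: T = span u v by rewrite setD1K.
split; last first.
  by move=> x /par[y yS py]; exists y; rewrite ?py // rT.
case/is_forestP: (f0) => h hp.
apply/setP=> p; apply/containingP/agreeingP=> [[fp qu qv] | [fp eT]].
  by split=> // x /par[y yS qy]; rewrite !qy.
split=> //; apply/chainP=> i j eij.
  rewrite eT; first by apply/chainP: i j eij.
  rewrite !inE mem_tnth andbT; apply/eqP=> /ui j0.
  by rewrite j0 in eij.
rewrite eT; first by apply/chainP: i j eij.
rewrite !inE mem_tnth orbT andbT; apply/eqP=> er.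
(* Were [r] a later vertex of [v], its rank would exceed that of the first vertex of [v]; but the
   latter lies on [u] and has at least the rank of [r]. *)
have /tnthP[l el] := vu.
have: h (tnth v ord0) < h (tnth v j) by apply: chain_rank pv hp _; rewrite eij.
rewrite er el; case: (posnP l) => [l0 | l0].
  by rewrite (_ : l = ord0) ?ltnn //; apply: val_inj.
by rewrite ltnNge ltnW //; apply: chain_rank pu hp _.
Qed.

(* All terms of this maximum are equal. *)
Definition star_count n s : nat :=
  \max_(T : {set 'I_n}) \max_(r | (r \notin T) && (#|T|.+1 == s))
    #|agreeing T (star T r)|.

Lemma star_countE n (T : {set 'I_n}) r :
  r \notin T -> star_count n #|T|.+1 = #|agreeing T (star T r)|.
Proof.
move=> rT; apply/eqP; rewrite eqn_leq; apply/andP; split.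
  apply/bigmax_leqP=> T' _; apply/bigmax_leqP=> r' /andP[rT' /eqP[eT]].
  exact: leq_star.
apply: leq_trans (leq_bigmax T).
by apply: (leq_bigmax_cond (F := fun r => #|agreeing T (star T r)|)); rewrite rT eqxx.
Qed.

Lemma card_containing n k (u v : k.+1.-tuple 'I_n) :
    injective (tnth u) -> injective (tnth v) -> overlap u v ->
  containing u v != set0 -> #|containing u v| = star_count n #|span u v|.
Proof.
move=> ui vi uv /set0Pn[p0 p0uv].
wlog vu : u v ui vi uv p0uv / tnth v ord0 \in u.
  move=> IH; case/containingP: (p0uv) => _ pu pv.
  have [|uv0] := chain_overlap pu pv uv; first exact: IH.
  by rewrite containingC spanC; apply: IH; rewrite // 1?overlapC // containingC.
have [-> pT] := containing_agreeing ui p0uv vu.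
set r := tnth u ord0 in pT *; set T := _ :\ r in pT *.
have rT : r \notin T by rewrite setD11.
have rS : r \in span u v by rewrite !inE mem_tnth.
case/containingP: p0uv => f0 _ _.
by rewrite (cardsD1 r) rS add1n -/T (star_countE rT); apply: card_agreeing_star.
Qed.

(** Positivity allows this factor to be cancelled in [eq_linked_pairs]. The star with root 0 and
    leaves 1, ..., s - 1 is a witness. *)
Lemma star_count_gt0 n s : 0 < s <= n -> 0 < star_count n s.
Proof.
case: n => [|n]; first by case: s.
case: s => // s /andP[_]; rewrite ltnS => sn.
have [T TD cT] : exists2 T : {set 'I_n.+1}, ord0 \notin T & #|T| = s.
  exists [set x : 'I_n.+1 | 0 < x <= s]; rewrite ?inE //.
  pose f (i : 'I_s) : 'I_n.+1 := inord i.+1.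
  have fE i : f i = i.+1 :> nat by rewrite inordK //; have := ltn_ord i; lia.
  rewrite -[RHS]card_ord -(card_imset _ (f := f)).
    apply: eq_card => x; rewrite inE; apply/idP/imsetP=> [/andP[x0 xs] | [i _ ->]].
      have xs' : x.-1 < s by lia.
      by exists (Ordinal xs') => //; apply: val_inj; rewrite /= fE /= prednK.
    by rewrite fE /=.
  by move=> i j /(congr1 val); rewrite /= !fE => -[]; apply: val_inj.
rewrite -cT (star_countE TD); apply/card_gt0P; exists (star T ord0).
by apply/agreeingP; split=> //; apply: star_forest.
Qed.

(** * Changing the pattern by permuting positions *)

Definition reorder n k (pi : 'S_k) (u : k.-tuple 'I_n) : k.-tuple 'I_n :=
  [tuple tnth u (pi i) | i < k].

Lemma reorderK n k (pi : 'S_k) : cancel (@reorder n k pi) (reorder pi^-1).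
Proof. by move=> u; apply: eq_from_tnth => i; rewrite !tnth_mktuple permKV. Qed.

Lemma reorder_bij n k (pi : 'S_k) : bijective (@reorder n k pi).
Proof.
exists (reorder pi^-1); first exact: reorderK.
by move=> u; have := reorderK pi^-1 u; rewrite invgK.
Qed.

Lemma mem_reorder n k (pi : 'S_k) (u : k.-tuple 'I_n) : reorder pi u =i u.
Proof.
move=> x; apply/tnthP/tnthP=> [[i ->] | [i ->]].
  by exists (pi i); rewrite tnth_mktuple.
by exists ((pi^-1)%g i); rewrite tnth_mktuple permKV.
Qed.

(** In [pi * s] the factor [pi] acts first, so [pi = t * s^-1] turns tuples of type [s] into tuples
    of type [t] on the same vertices. *)
Lemma order_type_reorder n k (s pi : 'S_k) (u : k.-tuple 'I_n) :
  order_type (pi * s)%g (reorder pi u) = order_type s u.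
Proof.
apply/order_typeP/order_typeP=> H i j; last by rewrite !tnth_mktuple !permM H.
by have := H ((pi^-1)%g i) ((pi^-1)%g j); rewrite !tnth_mktuple !permM !permKV.
Qed.

Lemma card_order_type n k (s t : 'S_k) :
  #|[set u : k.-tuple 'I_n | order_type s u]| =
  #|[set u : k.-tuple 'I_n | order_type t u]|.
Proof.
rewrite -(card_imset _ (bij_inj (reorder_bij n (t * s^-1)%g))).
apply: eq_card => v; rewrite inE; apply/imsetP/idP=> [[u] | tv].
  by rewrite inE => su ->; have := order_type_reorder s (t * s^-1) u; rewrite mulgKV su.
have [g _ gK] := reorder_bij n (t * s^-1)%g.
by exists (g v); rewrite ?gK // inE -(order_type_reorder s (t * s^-1)) gK mulgKV.
Qed.

(** Without repetitions in [u ++ v] and [u' ++ v'], a single relabelling carries [u] to [u'] and [v]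
    to [v']. *)
Lemma leq_containing_disjoint n k (u v u' v' : k.-tuple 'I_n) :
    uniq (u ++ v) -> uniq (u' ++ v') ->
  #|containing u v| <= #|containing u' v'|.
Proof.
move=> uv uv'; have [|pi] := perm_extend uv uv'; first by rewrite !size_cat !size_tuple.
rewrite map_cat => /eqP; rewrite eqseq_cat ?size_map ?size_tuple //.
case/andP=> /eqP eu /eqP ev.
have {eu}euu i : tnth u' i = pi (tnth u i).
  by rewrite (_ : u' = map_tuple pi u) ?tnth_map //; apply: val_inj.
have {ev}evv i : tnth v' i = pi (tnth v i).
  by rewrite (_ : v' = map_tuple pi v) ?tnth_map //; apply: val_inj.
rewrite -(card_imset _ (@relabel_inj _ pi)).
apply/subset_leq_card/subsetP=> _ /imsetP[p /containingP[fp /chainP pu /chainP pv] ->].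
apply/containingP; split; first exact: relabel_forest.
  by apply/chainP=> i j eij; rewrite !euu relabelE (pu i).
by apply/chainP=> i j eij; rewrite !evv relabelE (pv i).
Qed.

Lemma card_containing_disjoint n k (u v u' v' : k.-tuple 'I_n) :
    uniq (u ++ v) -> uniq (u' ++ v') ->
  #|containing u v| = #|containing u' v'|.
Proof.
by move=> uv uv'; apply/eqP; rewrite eqn_leq !leq_containing_disjoint.
Qed.

(** * Second moments *)

Lemma sum_by_value (T : finType) (A : {set T}) (g : T -> nat) (G : nat -> nat) B :
    (forall x, g x < B) ->
  \sum_(x in A) G (g x) = \sum_(m < B) #|[set x in A | g x == m]| * G m.
Proof.
move=> gB; rewrite (partition_big (fun x => Ordinal (gB x)) predT) //=.
apply: eq_bigr => m _; rewrite (eq_bigr (fun _ => G m)); last first.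
  by move=> x /andP[_ /eqP <-].
rewrite sum_nat_const; congr (_ * _); apply: eq_card => x.
by rewrite unfold_in inE -val_eqE.
Qed.

Lemma num_instancesE n k (s : 'S_k) (p : parent_map n) :
  num_instances s p = \sum_(u : k.-tuple 'I_n | order_type s u) chain p u.
Proof.
rewrite /num_instances -sum1_card big_mkcond [RHS]big_mkcond /=.
apply: eq_bigr => u _; rewrite inE /consecutive_instance -/(chain p u) -/(order_type s u).
by case: (chain p u); case: (order_type s u).
Qed.

Definition second_moment n k (s : 'S_k) : nat :=
  \sum_(z : k.-tuple 'I_n * k.-tuple 'I_n | order_type s z.1 && order_type s z.2)
    #|containing z.1 z.2|.

Lemma second_momentE n k (s : 'S_k) :
  \sum_(p in forests n) num_instances s p ^ 2 = second_moment n s.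
Proof.
under eq_bigr => p _.
  rewrite -mulnn num_instancesE big_distrlr /= pair_big /=.
  over.
rewrite exchange_big /=; apply: eq_bigr => z _.
rewrite -sum1_card big_mkcond [RHS]big_mkcond /=; apply: eq_bigr => p _.
by rewrite !inE; case: (is_forest p); case: (chain p _); case: (chain p _).
Qed.

(** A second moment depends only on the distribution of [num_instances], whose values are bounded by
    the number of all tuples. *)
Lemma eq_second_moment n k (s t : 'S_k) :
  strong_c_forest_Wilf_equivalent s t -> second_moment n s = second_moment n t.
Proof.
move=> st; rewrite -!second_momentE.
have num_lt (r : 'S_k) (p : parent_map n) : num_instances r p < #|{: k.-tuple 'I_n}|.+1.
  by rewrite ltnS max_card.
rewrite !(@sum_by_value _ _ _ (fun m => m ^ 2) _ (num_lt _)).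
by apply: eq_bigr => m _; rewrite st.
Qed.

Lemma disjoint_uniq n k (s : 'S_k) (u v : k.-tuple 'I_n) :
  order_type s u -> order_type s v -> ~~ overlap u v -> uniq (u ++ v).
Proof.
move=> su sv uv; rewrite cat_uniq !inj_tuple_uniq ?andbT //=.
- by rewrite has_sym.
- exact: order_type_inj sv.
- exact: order_type_inj su.
Qed.

(** Permuting the positions of both tuples alike matches pairs of type [s] with pairs of type [t].
    Supports are kept, hence disjointness, and all disjoint pairs lie in equally many forests. *)
Lemma disjoint_second_moment n k (s t : 'S_k) :
  \sum_(z : k.-tuple 'I_n * k.-tuple 'I_n
        | order_type s z.1 && order_type s z.2 && ~~ overlap z.1 z.2)
    #|containing z.1 z.2| =
  \sum_(z : k.-tuple 'I_n * k.-tuple 'I_n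
        | order_type t z.1 && order_type t z.2 && ~~ overlap z.1 z.2)
    #|containing z.1 z.2|.
Proof.
pose pi := (t * s^-1)%g.
pose f (z : k.-tuple 'I_n * k.-tuple 'I_n) := (reorder pi z.1, reorder pi z.2).
have fbij : bijective f.
  have [g gK Kg] := @reorder_bij n k pi.
  by exists (fun z => (g z.1, g z.2)) => -[u v]; rewrite /f /= ?gK ?Kg.
have piE (u : k.-tuple 'I_n) : order_type t (reorder pi u) = order_type s u.
  by rewrite -[RHS](order_type_reorder s pi) mulgKV.
have overE (z : k.-tuple 'I_n * k.-tuple 'I_n) : overlap (f z).1 (f z).2 = overlap z.1 z.2.
  rewrite /overlap (eq_has_r (mem_reorder pi z.1)).
  by apply: eq_has => x /=; apply: mem_reorder.
rewrite [RHS](reindex f) /=; last exact: onW_bij.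
apply: eq_big => [z | z /andP[/andP[s1 s2] d]]; first by rewrite overE !piE.
apply: card_containing_disjoint; first exact: disjoint_uniq s1 s2 d.
by apply: (@disjoint_uniq _ _ t); rewrite ?piE // (overE z).
Qed.

(** For [S = setT] the cardinality is the number L(n) of the overview; [card_linked_pairs] reduces
    any other [S] to this case. *)
Definition linked_pairs n k (s : 'S_k) (S : {set 'I_n}) :=
  [set z : k.-tuple 'I_n * k.-tuple 'I_n |
    [&& order_type s z.1, order_type s z.2, overlap z.1 z.2,
        containing z.1 z.2 != set0 & span z.1 z.2 == S]].

Lemma linked_second_moment n k (s : 'S_k.+1) :
  \sum_(z : k.+1.-tuple 'I_n * k.+1.-tuple 'I_n
        | order_type s z.1 && order_type s z.2 && overlap z.1 z.2)
    #|containing z.1 z.2| =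
  \sum_(S : {set 'I_n}) #|linked_pairs s S| * star_count n #|S|.
Proof.
rewrite (bigID (fun z => containing z.1 z.2 != set0)) /=.
rewrite [X in _ + X]big1 ?addn0; last first.
  by move=> z /andP[_ /negPn/eqP->]; rewrite cards0.
rewrite (partition_big (fun z => span z.1 z.2) predT) //=.
apply: eq_bigr => S _; rewrite -sum_nat_const; apply: eq_big => z.
  by rewrite inE -!andbA.
case/andP=> /andP[/andP[/andP[su sv] uv] c0] /eqP <-.
by apply: card_containing c0 => //; [apply: order_type_inj su | apply: order_type_inj sv].
Qed.

(** * Transfer along an order embedding *)

Section Transfer.
Variables (m n : nat) (f : 'I_m -> 'I_n).
Hypothesis f_mono : forall i j, (f i < f j) = (i < j).

Lemma mono_ord_inj : injective f.
Proof.
move=> i j eij; apply: val_inj => /=.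
by have := f_mono i j; have := f_mono j i; rewrite eij ltnn; lia.
Qed.

Definition pinv (y : 'I_n) : option 'I_m := [pick x | f x == y].

Lemma pinvK x : pinv (f x) = Some x.
Proof.
rewrite /pinv; case: pickP => [y /eqP/mono_ord_inj-> // | /(_ x)].
by rewrite eqxx.
Qed.

Lemma pinvE y x : pinv y = Some x -> f x = y.
Proof. by rewrite /pinv; case: pickP => // z /eqP <- [->]. Qed.

Lemma order_type_map k (s : 'S_k) (u : k.-tuple 'I_m) :
  order_type s (map_tuple f u) = order_type s u.
Proof.
by apply/order_typeP/order_typeP=> H i j; have := H i j; rewrite !tnth_map f_mono.
Qed.

Lemma overlap_map k (u v : k.-tuple 'I_m) :
  overlap (map_tuple f u) (map_tuple f v) = overlap u v.
Proof.
rewrite /overlap has_map; apply: eq_has => x /=.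
by rewrite mem_map //; apply: mono_ord_inj.
Qed.

Lemma span_map k (u v : k.-tuple 'I_m) :
  span (map_tuple f u) (map_tuple f v) = f @: span u v.
Proof.
rewrite imsetU; congr (_ :|: _); apply/setP=> y; rewrite inE;
  by apply/mapP/imsetP=> -[x xu ->]; exists x; rewrite ?inE // in xu *.
Qed.

(** Pulling a forest back along [f] drops the parents outside the image; pushing one forward makes
    the vertices outside the image isolated. *)
Lemma containing_map k (u v : k.-tuple 'I_m) :
  (containing (map_tuple f u) (map_tuple f v) != set0) = (containing u v != set0).
Proof.
apply/set0Pn/set0Pn=> -[p /containingP[/is_forestP[h hp] /chainP pu /chainP pv]].
  exists [ffun x => obind pinv (p (f x))]; apply/containingP; split.
  - apply/is_forestP; exists (h \o f) => x y; rewrite ffunE.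
    by case E: (p (f x)) => [z|] //= /pinvE fy; apply: hp; rewrite E fy.
  - by apply/chainP=> i j eij; have := pu i j eij; rewrite !tnth_map ffunE => -> /=; rewrite pinvK.
  - by apply/chainP=> i j eij; have := pv i j eij; rewrite !tnth_map ffunE => -> /=; rewrite pinvK.
exists [ffun y => omap f (obind p (pinv y))]; apply/containingP; split.
- apply/is_forestP; exists (fun y => oapp h 0 (pinv y)) => x y; rewrite ffunE.
  case: (pinv x) => [z|] //=; case E: (p z) => [w|] //= [<-].
  by rewrite pinvK; apply: hp.
- by apply/chainP=> i j eij; rewrite !tnth_map ffunE pinvK /= (pu i j).
- by apply/chainP=> i j eij; rewrite !tnth_map ffunE pinvK /= (pv i j).
Qed.

Lemma tuple_in_image k (u : k.-tuple 'I_n) :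
  {subset u <= f @: setT} -> exists u0, u = map_tuple f u0.
Proof.
move=> uf; have /fin_all_exists[g gP] : forall i, exists x, f x = tnth u i.
  by move=> i; have /imsetP[x _ ->] := uf _ (mem_tnth i u); exists x.
exists [tuple g i | i < k]; apply: eq_from_tnth => i.
by rewrite tnth_map tnth_mktuple gP.
Qed.

Lemma card_linked_pairs_image k (s : 'S_k) :
  #|linked_pairs s (f @: setT)| = #|linked_pairs s [set: 'I_m]|.
Proof.
pose F (z : k.-tuple 'I_m * k.-tuple 'I_m) := (map_tuple f z.1, map_tuple f z.2).
have mapI : injective (@map_tuple k _ _ f).
  move=> u v /(congr1 val) /= /inj_map euv; apply: val_inj; apply: euv.
  exact: mono_ord_inj.
rewrite -(card_imset _ (f := F)); last first.
  by move=> [u v] [u' v'] [] eu ev; congr (_, _); apply: mapI; apply: val_inj.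
have spanE (u v : k.-tuple 'I_m) : (f @: span u v == f @: setT) = (span u v == setT).
  by rewrite (inj_eq (imset_inj mono_ord_inj)).
apply: eq_card => -[u v]; apply/idP/imsetP=> [|[[u0 v0] z0 ->]]; last first.
  by move: z0; rewrite !inE /= !order_type_map overlap_map containing_map span_map spanE.
move=> zP; have /eqP sE : span u v == f @: setT by move: zP; rewrite inE => /and5P[].
have [|u0 eu] := @tuple_in_image _ u.
  by move=> x xu; rewrite -sE !inE xu.
have [|v0 ev] := @tuple_in_image _ v.
  by move=> x xv; rewrite -sE !inE xv orbT.
exists (u0, v0); last by rewrite eu ev.
by move: zP; rewrite eu ev !inE /= !order_type_map overlap_map containing_map span_map spanE.
Qed.

End Transfer.

(** The list [enum S] is a subsequence of the increasing enumeration of ['I_n]. This makes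
    [enum_val] an embedding as required by the transfer. *)
Lemma enum_val_mono n (S : {set 'I_n}) (i j : 'I_#|S|) :
  (enum_val i < enum_val j) = (i < j).
Proof.
have srt : sorted (relpre val ltn) (enum S).
  rewrite -sorted_map; apply: (@subseq_sorted _ ltn ltn_trans _ (iota 0 n));
    last exact: iota_ltn_sorted.
  rewrite -val_enum_ord; apply: map_subseq; rewrite [X in subseq X _]/enum_mem -enumT.
  exact: filter_subseq.
have lt a b : a < b -> b < #|S| -> forall x0, nth x0 (enum S) a < nth x0 (enum S) b.
  move=> ab bS x0.
  have tr : transitive (relpre (@nat_of_ord n) ltn) by move=> x y z; apply: ltn_trans.
  by apply: (sorted_ltn_nth tr x0 srt) => //; rewrite inE -cardE //; apply: ltn_trans bS.
have x0 := enum_val i; rewrite !(enum_val_nth x0).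
case: (ltngtP i j) => [ij | ji | ->]; last by rewrite ltnn.
  by rewrite lt.
by apply/negbTE; rewrite -leqNgt ltnW // lt.
Qed.

(** * Induction on the number of vertices covered *)

Lemma card_linked_pairs n k (s : 'S_k) (S : {set 'I_n}) :
  #|linked_pairs s S| = #|linked_pairs s [set: 'I_#|S|]|.
Proof.
rewrite -(card_linked_pairs_image (@enum_val_mono n S)); congr #|linked_pairs s _|.
apply/setP=> x; apply/idP/imsetP=> [xS | [i _ ->]]; last exact: enum_valP.
by exists (enum_rank_in xS x); rewrite ?enum_rankK_in.
Qed.

Lemma linked_pairs0 k (s : 'S_k.+1) n : linked_pairs s (set0 : {set 'I_n}) = set0.
Proof.
apply/setP=> z; rewrite !inE; apply/negP=> /and5P[_ _ _ _ /eqP/setP/(_ (tnth z.1 ord0))].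
by rewrite !inE mem_tnth.
Qed.

Lemma eq_linked_pairs k (s t : 'S_k.+1) n :
    strong_c_forest_Wilf_equivalent s t ->
  #|linked_pairs s [set: 'I_n]| = #|linked_pairs t [set: 'I_n]|.
Proof.
move=> st; elim/ltn_ind: n => n IHn.
have [-> | n_gt0] := posnP n.
  suff T0 : [set: 'I_0] = set0 by rewrite T0 !linked_pairs0.
  by apply/setP=> -[].
have := eq_second_moment n st; rewrite /second_moment.
rewrite (bigID (fun z => overlap z.1 z.2)) /=.
rewrite [in RHS](bigID (fun z => overlap z.1 z.2)) /=.
(* Once the disjoint pairs are cancelled, the proper supports agree by induction and only the term
   of the full support remains. *)
rewrite (disjoint_second_moment n s t) !linked_second_moment => /addIn.
rewrite (bigD1 setT) // [in RHS](bigD1 setT) //= cardsT card_ord.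
rewrite [X in _ + X = _ -> _](eq_bigr (fun S => #|linked_pairs t S| * star_count n #|S|)).
  move=> /addIn /eqP; rewrite eqn_pmul2r ?star_count_gt0 ?n_gt0 ?leqnn //.
  by move/eqP.
move=> S; rewrite -properT => ST; congr (_ * _).
rewrite (card_linked_pairs s S) (card_linked_pairs t S) IHn //.
by have := proper_card ST; rewrite cardsT card_ord.
Qed.

(** * Tuples of a given order type and their supports *)

Lemma card_ord_lt n m : m <= n -> #|[set x : 'I_n | x < m]| = m.
Proof.
move=> mn; rewrite -[RHS]card_ord -cardsT.
rewrite -(card_imset _ (f := widen_ord mn)); last first.
  by move=> i j /(congr1 val) eij; apply: val_inj.
apply: eq_card => x; rewrite inE; apply/idP/imsetP=> [xm | [i _ ->]] /=; last exact: ltn_ord.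
by exists (Ordinal xm) => //; apply: val_inj.
Qed.

Lemma card_below_order_type n k (s : 'S_k) (u : k.-tuple 'I_n) i :
  order_type s u -> #|[set y in u | y < tnth u i]| = s i.
Proof.
move=> su; have ui := order_type_inj su.
rewrite -[RHS](@card_ord_lt k) 1?ltnW //.
rewrite -(card_imset _ (f := fun x => tnth u ((s^-1)%g x))); last first.
  by move=> x y /ui /perm_inj.
move/order_typeP: su => su.
apply: eq_card => y; rewrite inE; apply/andP/imsetP.
  case=> /tnthP[j ->]; rewrite su => sij.
  by exists (s j); rewrite ?inE // permK.
case=> x; rewrite inE => xi ->; rewrite mem_tnth; split=> //.
by rewrite su permKV.
Qed.

(** The rank of an entry within the common support is the value of [s] at its position, and so
    determines the position. *)
Lemma order_type_unique n k (s : 'S_k) (u v : k.-tuple 'I_n) :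
  order_type s u -> order_type s v -> u =i v -> u = v.
Proof.
move=> su sv uv; apply: eq_from_tnth => i.
have /tnthP[j ej] : tnth u i \in v by rewrite -uv mem_tnth.
suff e : i = j by rewrite ej e.
apply/(@perm_inj _ s)/val_inj => /=.
rewrite -(card_below_order_type i su) -(card_below_order_type j sv).
by apply: eq_card => y; rewrite !inE uv ej.
Qed.

Lemma order_type_exists n k (s : 'S_k) (S : {set 'I_n}) :
  #|S| = k -> exists2 u : k.-tuple 'I_n, order_type s u & u =i S.
Proof.
move=> eS; case: k / eS s => s.
exists [tuple enum_val (s i) | i < #|S|].
  by apply/order_typeP=> i j; rewrite !tnth_mktuple enum_val_mono.
move=> x; apply/tnthP/idP=> [[i ->] | xS]; first by rewrite tnth_mktuple enum_valP.
exists ((s^-1)%g (enum_rank_in xS x)).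
by rewrite tnth_mktuple permKV enum_rankK_in.
Qed.

Lemma card_support n k (s : 'S_k) (u : k.-tuple 'I_n) :
  order_type s u -> #|[set x in u]| = k.
Proof.
by move=> /order_type_inj/inj_tuple_uniq/card_uniqP; rewrite cardsE size_tuple.
Qed.

(** * Pairs covering 2K + 1 = 2k - 1 vertices, where k = K + 1 *)

Section Cover.
Variables (K : nat) (s : 'S_K.+1).
Notation tup := (K.+1.-tuple 'I_K.*2.+1).
Implicit Types u v : tup.

(** The supports share 2(K + 1) - (2K + 1) = 1 vertex. *)
Lemma cover_meet1 u v x y :
    order_type s u -> order_type s v -> span u v = setT ->
  x \in u -> x \in v -> y \in u -> y \in v -> x = y.
Proof.
move=> su sv uv xu xv yu yv.
have := cardsUI [set x in u] [set x in v].
rewrite -/(span u v) uv cardsT card_ord !(card_support su, card_support sv).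
move=> e; have c1 : #|[set x in u] :&: [set x in v]| <= 1 by lia.
by move/card_le1_eqP: c1 => /(_ y x); apply; rewrite !inE ?xu ?yu.
Qed.

(** The only common vertex is the first of [v], to which [v] gives no parent. Hence the chains never
    prescribe conflicting parents, and [v] can be hung below [u] at that vertex. *)
Lemma cover_containing u v :
    order_type s u -> order_type s v -> span u v = setT -> tnth v ord0 \in u ->
  containing u v != set0.
Proof.
move=> su sv uv v0u.
have only x : x \in u -> x \in v -> x = tnth v ord0.
  by move=> xu xv; apply: cover_meet1 su sv uv xu xv v0u (mem_tnth _ _).
have [ui vi] := (order_type_inj su, order_type_inj sv).
have [uu uv'] := (inj_tuple_uniq ui, inj_tuple_uniq vi).
have idx (w : tup) i : uniq w -> index (tnth w i) w = i.
  by move=> ww; rewrite (tnth_nth ord0) index_uniq ?size_tuple.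
have v0 : index (tnth v ord0) v = 0 by rewrite idx.
pose up (w : tup) x := nth ord0 w (index x w).-1.
pose p : parent_map K.*2.+1 := [ffun x =>
  if (x \in v) && (0 < index x v) then Some (up v x) else
  if (x \in u) && (0 < index x u) then Some (up u x) else None].
have upE (w : tup) (i j : 'I_K.+1) : uniq w -> j = i.+1 :> nat -> up w (tnth w j) = tnth w i.
  by move=> ww eij; rewrite /up idx // eij /= -tnth_nth.
have mem_up (w : tup) x : x \in w -> up w x \in w.
  by move=> xw; apply: mem_nth; apply: leq_ltn_trans (leq_pred _) _; rewrite index_mem.
have idx_up (w : tup) x : uniq w -> x \in w -> index (up w x) w = (index x w).-1.
  move=> ww xw; rewrite index_uniq //; apply: leq_ltn_trans (leq_pred _) _.
  by rewrite index_mem.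
apply/set0Pn; exists p; apply/containingP; split.
(* The rank is the depth in the glued tree: along [v] it is shifted by the depth in [u] of the
   vertex where [v] is attached. *)
- apply/is_forestP; exists (fun x => if x \in u then index x u
      else index (tnth v ord0) u + index x v) => x y.
  rewrite ffunE; case: ifP => [/andP[xv x0] [<-] | _].
    have -> : (x \in u) = false.
      by apply/negP=> xu; rewrite (only x xu xv) v0 in x0.
    case: ifP => [yu|_]; last by rewrite ltn_add2l idx_up // prednK.
    by rewrite (only _ yu (mem_up _ _ xv)) -[X in X < _]addn0 ltn_add2l.
  case: ifP => // /andP[xu x0] [<-].
  by rewrite mem_up // xu idx_up // prednK.
- apply/chainP=> i j eij; rewrite ffunE (upE _ _ _ uu eij) mem_tnth idx // eij /=.
  case: ifP => // /andP[jv]; rewrite (only _ (mem_tnth _ _) jv) v0.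
  by [].
- apply/chainP=> i j eij.
  by rewrite ffunE (upE _ _ _ uv' eij) mem_tnth idx // eij.
Qed.

Definition rooted_pairs :=
  [set z : tup * tup | [&& order_type s z.1, order_type s z.2,
     span z.1 z.2 == setT & tnth z.2 ord0 \in z.1]].

Definition same_root_pairs :=
  [set z : tup * tup | [&& order_type s z.1, order_type s z.2,
     span z.1 z.2 == setT & tnth z.1 ord0 == tnth z.2 ord0]].

Definition flip (z : tup * tup) := (z.2, z.1).

Lemma flipK : involutive flip. Proof. by case. Qed.

Lemma mem_flip_rooted z : (z \in flip @: rooted_pairs) =
  [&& order_type s z.1, order_type s z.2, span z.1 z.2 == setT & tnth z.1 ord0 \in z.2].
Proof.
rewrite -[z in LHS]flipK mem_imset ?inE; last exact: inv_inj flipK.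
by rewrite /= spanC; case: (order_type s z.1); case: (order_type s z.2).
Qed.

(** One inclusion is [chain_overlap], the other [cover_containing]. *)
Lemma linked_pairs_cover :
  linked_pairs s [set: 'I_K.*2.+1] = rooted_pairs :|: flip @: rooted_pairs.
Proof.
apply/setP=> -[u v]; rewrite in_setU mem_flip_rooted !inE /=.
have [su|] //= := boolP (order_type s u).
have [sv|] //= := boolP (order_type s v).
have [uv|] /= := eqVneq (span u v) setT; last by rewrite !andbF.
rewrite andbT; apply/andP/orP=> [[ov /set0Pn[p /containingP[_ pu pv]]] | [vu | uv0]].
- by have [|] := chain_overlap pu pv ov; [left | right].
- split; last exact: cover_containing.
  by apply/hasP; exists (tnth v ord0); rewrite //= mem_tnth.
- split; first by apply/hasP; exists (tnth u ord0); rewrite //= mem_tnth.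
  by rewrite containingC; apply: cover_containing => //; rewrite spanC.
Qed.

(** In the intersection both first vertices are common to the two supports, which meet only once. *)
Lemma rooted_flip_rooted : rooted_pairs :&: flip @: rooted_pairs = same_root_pairs.
Proof.
apply/setP=> -[u v]; rewrite in_setI mem_flip_rooted !inE /=.
have [su|] //= := boolP (order_type s u).
have [sv|] //= := boolP (order_type s v).
have [uv|] //= := eqVneq (span u v) setT.
apply/andP/eqP=> [[vu uv0] | e]; last by rewrite e mem_tnth -e mem_tnth.
by apply: cover_meet1 su sv uv _ _ _ _; rewrite ?mem_tnth.
Qed.

Lemma span_memC u v x y :
    order_type s u -> order_type s v -> span u v = setT -> x \in u -> x \in v ->
  (y \in u) = (y == x) || (y \notin v).
Proof.
move=> su sv uv xu xv; have [-> // | yx] := eqVneq y x.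
have : (y \in u) || (y \in v) by move/setP/(_ y): (uv); rewrite !inE.
case yu: (y \in u); case yv: (y \in v) => //= _.
by case/eqP: yx; apply: cover_meet1 su sv uv yu yv xu xv.
Qed.

Lemma complement_exists v x :
    order_type s v -> x \in v ->
  exists2 u, order_type s u & span u v = setT /\ u =i (x |: ~: [set y in v]).
Proof.
move=> sv xv; have [|u su eu] := @order_type_exists _ _ s (x |: ~: [set y in v]).
  have xC : x \notin ~: [set y in v] by rewrite !inE xv.
  rewrite cardsU1 xC; apply: (@addnI K.+1).
  rewrite addnCA -[X in 1 + (X + _)](card_support sv) cardsC card_ord; lia.
exists u => //; split=> //; apply/setP=> y; rewrite !inE eu !inE.
by case: (y \in v); rewrite ?orbT.
Qed.

(** The second component determines the first: its support is forced, and a set of K + 1 vertices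
    carries exactly one tuple of type [s]. *)
Lemma card_rooted_pairs : #|rooted_pairs| = #|[set u : tup | order_type s u]|.
Proof.
rewrite -(card_in_imset (f := snd)).
  apply: eq_card => v; rewrite !inE; apply/imsetP/idP.
    by case=> z; rewrite inE => /and4P[_ sv _ _] ->.
  move=> sv; have [u su [uv eu]] := complement_exists sv (mem_tnth ord0 v).
  by exists (u, v); rewrite // inE su sv uv eqxx /= eu setU11.
move=> [u v] [u' v']; rewrite !inE /= => /and4P[su sv /eqP uv vu].
move=> /and4P[su' _ /eqP uv' vu'] ev; rewrite -{v'}ev in uv' vu' *.
congr (_, _); apply: (order_type_unique su su') => y.
by rewrite (span_memC y su sv uv vu) ?mem_tnth // (span_memC y su' sv uv' vu') ?mem_tnth.
Qed.

(** Inclusion-exclusion, stated additively to avoid truncated subtraction. By [card_order_type] the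
    right-hand side is the same for all patterns. *)
Lemma card_linked_pairs_cover :
  #|linked_pairs s [set: 'I_K.*2.+1]| + #|same_root_pairs| =
  #|[set u : tup | order_type s u]|.*2.
Proof.
rewrite linked_pairs_cover -rooted_flip_rooted cardsUI card_imset; last exact: inv_inj flipK.
by rewrite card_rooted_pairs addnn.
Qed.

End Cover.

(** * Splitting a set at one of its elements *)

Section Split.
Variables (n : nat) (x : 'I_n).

Definition below := [set y : 'I_n | y < x].
Definition above := [set y : 'I_n | x < y].

Lemma card_below : #|below| = x.
Proof. by rewrite card_ord_lt // ltnW. Qed.

Lemma setIU_below_above (A : {set 'I_n}) :
  x \in A -> x |: ((A :&: below) :|: (A :&: above)) = A.
Proof.
move=> xA; apply/setP=> y; rewrite !inE.
have [-> // | yx] := eqVneq y x; rewrite -andb_orr.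
by rewrite -neq_ltn -(inj_eq val_inj) /= in yx *; rewrite yx andbT.
Qed.

Lemma card_below_above (A : {set 'I_n}) :
  x \in A -> #|A| = 1 + (#|A :&: below| + #|A :&: above|).
Proof.
move=> xA; rewrite -[in LHS](setIU_below_above xA) cardsU1 !inE ltnn !andbF /=.
congr (_ + _); apply/eqP; rewrite (leq_card_setU _ _).
apply/pred0P=> y /=; rewrite !inE.
by case: ltngtP; rewrite ?andbF.
Qed.

Lemma card_above : #|above| = n - x.+1.
Proof.
have := card_below_above (in_setT x); rewrite cardsT card_ord !setTI card_below.
by move=> e; apply/esym/eqP; rewrite -(eqn_add2l x.+1) subnKC // addSn -add1n -e.
Qed.

(** The parts of [A] below and above [x] can be chosen independently and determine [A]. *)
Lemma card_split_sets a b :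
  #|[set A : {set 'I_n} | [&& x \in A, #|A :&: below| == a & #|A :&: above| == b]]|
  = 'C(x, a) * 'C(n - x.+1, b).
Proof.
rewrite -card_above -card_below -!cards_draws -cardsX.
rewrite -(card_in_imset (f := fun A : {set 'I_n} => (A :&: below, A :&: above))).
  apply: eq_card => -[B C]; rewrite !inE /=; apply/imsetP/idP.
    by case=> A; rewrite inE => /and3P[_ Aa Ab] [-> ->]; rewrite !subsetIr Aa Ab.
  case/andP=> /andP[/subsetP Bs Ba] /andP[/subsetP Cs Cb].
  have Bx y : y \in B -> y < x by move/Bs; rewrite inE.
  have Cx y : y \in C -> x < y by move/Cs; rewrite inE.
  have eB : (x |: (B :|: C)) :&: below = B.
    apply/setP=> y; rewrite !inE; case: ltngtP => [yx | yx | yx].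
    - have [e|_] := eqVneq y x; first by rewrite e ltnn in yx.
      by rewrite andbT; case: (boolP (y \in C)) => [/Cx|_]; [lia | rewrite orbF].
    - by rewrite andbF; apply/esym/negP => /Bx; lia.
    - by rewrite andbF; apply/esym/negP => /Bx; lia.
  have eC : (x |: (B :|: C)) :&: above = C.
    apply/setP=> y; rewrite !inE; case: ltngtP => [yx | yx | yx].
    - have [e|_] := eqVneq y x; first by rewrite e ltnn in yx.
      by rewrite andbT; case: (boolP (y \in B)) => [/Bx|_]; [lia | rewrite ?orFb].
    - by rewrite andbF; apply/esym/negP => /Cx; lia.
    - by rewrite andbF; apply/esym/negP => /Cx; lia.
  by exists (x |: (B :|: C)); rewrite ?inE ?eB ?eC ?eqxx ?Ba ?Cb.
move=> A A'; rewrite !inE => /andP[xA _] /andP[xA' _] [eb ea].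
by rewrite -(setIU_below_above xA) eb ea setIU_below_above.
Qed.

End Split.

(** A pair is determined by the support [U] of its first tuple, as the second occupies the
    complement and the root. Each support has [a] labels below the root and together they exhaust
    these, so the root is 2a counted from 0. Above it, [U] takes K - a of the remaining 2(K - a)
    labels. *)
Lemma card_same_root_pairs K (s : 'S_K.+1) :
  #|same_root_pairs s| =
  'C((s ord0).*2, s ord0) * 'C((K - s ord0).*2, K - s ord0).
Proof.
set a := s ord0 : nat; have aK : a <= K by rewrite -ltnS ltn_ord.
have a2 : a.*2 < K.*2.+1 by rewrite ltnS leq_double.
pose x : 'I_K.*2.+1 := Ordinal a2.
have -> : (K - a).*2 = K.*2.+1 - x.+1 by rewrite subSS doubleB.
rewrite -[in LHS]/(a.*2) -[X in 'C(X, _) * _]/(nat_of_ord x) -card_split_sets.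
have below_u (w : K.+1.-tuple 'I_K.*2.+1) : order_type s w ->
    #|[set y in w] :&: below (tnth w ord0)| = a.
  move=> sw; rewrite /a -(card_below_order_type ord0 sw).
  by apply: eq_card => y; rewrite !inE.
rewrite -(card_in_imset
  (f := fun z : K.+1.-tuple 'I_K.*2.+1 * K.+1.-tuple 'I_K.*2.+1 => [set y in z.1])).
  apply: eq_card => U; rewrite inE; apply/imsetP/and3P.
    case=> -[u v]; rewrite inE /= => /and4P[su sv /eqP uv /eqP e] ->.
    have ex : tnth u ord0 = x.
      apply: val_inj => /=; rewrite -card_below.
      have := congr2 addn (below_u u su) (below_u v sv).
      rewrite addnn => <-; rewrite -e -cardsUI.
      have -> : [set y in u] :&: below (tnth u ord0) :&:
                ([set y in v] :&: below (tnth u ord0)) = set0.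
        apply/setP=> y; rewrite !inE; apply/negP=> /andP[/andP[yu yx] /andP[yv _]].
        suff ey : y = tnth u ord0 by rewrite ey ltnn in yx.
        by apply: cover_meet1 su sv uv yu yv _ _; rewrite ?mem_tnth // e mem_tnth.
      by rewrite cards0 addn0 -setIUl -/(span u v) uv setTI.
    have xu : x \in [set y in u] by rewrite inE -ex mem_tnth.
    have b := below_u u su; rewrite ex in b; rewrite xu b eqxx; split=> //.
    have := card_below_above xu; rewrite (card_support su) b => -[e'].
    by apply/eqP/(@addnI a); rewrite subnKC.
  case=> xU /eqP Ub /eqP Ua.
  have cU : #|U| = K.+1 by rewrite (card_below_above xU) Ub Ua add1n subnKC.
  have [u su eu] := order_type_exists s cU.
  have root_x (w : K.+1.-tuple 'I_K.*2.+1) : order_type s w -> x \in w ->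
      #|[set y in w] :&: below x| = a -> tnth w ord0 = x.
    move=> sw /tnthP[i ei] wb; rewrite ei; congr tnth; apply/(@perm_inj _ s)/val_inj.
    apply: etrans (esym wb) _ => /=; rewrite -(card_below_order_type i sw) -ei.
    by apply: eq_card => y; rewrite !inE.
  have uU : [set y in u] = U by apply/setP=> y; rewrite inE eu.
  have ux : tnth u ord0 = x by apply: root_x; rewrite ?eu ?uU.
  have xu : x \in u by rewrite eu.
  have [v sv [vu ev]] := complement_exists su xu.
  have vx : tnth v ord0 = x.
    apply: root_x; rewrite ?ev ?setU11 //.
    (* [U] leaves a of the 2a labels below [x] to [v], so by [root_x] the first vertex of [v] is
       [x]. *)
    have dU : a + #|below x :\: U| = a.*2.
      by rewrite -[RHS](card_below x) -(cardsID U (below x)) setIC Ub.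
    apply/(@addnI a); rewrite [RHS]addnn -[RHS]dU; congr (_ + _).
    apply: eq_card => y; rewrite !inE ev !inE eu.
    have [->|_] := eqVneq y x; first by rewrite ltnn !andbF.
    by rewrite andbC.
  by exists (u, v); rewrite ?uU // inE su sv spanC vu ux vx !eqxx.
move=> [u v] [u' v']; rewrite !inE /= => /and4P[su sv /eqP uv /eqP e].
move=> /and4P[su' sv' /eqP uv' /eqP e'] /setP uu'.
have eu : u = u' by apply: (order_type_unique su su') => y; have := uu' y; rewrite !inE.
rewrite -{u'}eu in su' uu' uv' e' *; congr (_, _); apply: (order_type_unique sv sv') => y.
rewrite spanC in uv; rewrite spanC in uv'.
have uin := mem_tnth ord0 u.
rewrite (span_memC y sv su uv _ uin) ?e ?mem_tnth //.
by rewrite (span_memC y sv' su uv' _ uin) ?e' ?mem_tnth // -e' e.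
Qed.

(** * Strict log-convexity of the central binomial coefficients *)

Definition central m := 'C(m.*2, m).

Lemma centralS m : m.+1 * central m.+1 = (m.*2.+1).*2 * central m.
Proof.
rewrite /central doubleS -mul_bin_diag /= -[in RHS]doubleMl.
have := mul_bin_down m.*2.+1 m; rewrite /= (_ : m.*2.+1 - m = m.+1); last by lia.
by move=> ->; rewrite doubleMl doubleS.
Qed.

Lemma central_gt0 m : 0 < central m.
Proof. by rewrite bin_gt0 -addnn leq_addr. Qed.

(** By [centralS] the quotient of consecutive values is 4 - 2/(m + 1), which increases with m;
    multiplying by [a.+1 * m.+1] clears the denominators. *)
Lemma central_step a m :
  a < m -> central a.+1 * central m < central a * central m.+1.
Proof.
move=> am; rewrite -(@ltn_pmul2l (a.+1 * m.+1)) ?muln_gt0 //.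
rewrite mulnACA centralS [X in _ < X]mulnACA centralS.
have : 0 < central a * central m by rewrite muln_gt0 !central_gt0.
move: (central a) (central m) => x y xy; nia.
Qed.

(** Each step lowers the smaller index and raises the larger one by 1, keeping their sum. *)
Lemma central_convex a b m :
  a < b -> b <= m -> central b * central m < central a * central (b - a + m).
Proof.
elim: b m => // b IHb m; rewrite ltnS leq_eqVlt => /predU1P[<- | ab] bm.
  by rewrite subSnn add1n; apply: central_step.
apply: ltn_trans (central_step bm) _.
by rewrite (subSn (ltnW ab)) addSnnS; apply: IHb => //; lia.
Qed.

(** The product is invariant under reflecting a to K - a, so both indices may be taken at most K/2,
    where it is strictly decreasing. *)
Lemma central_prod_inj K a b : a <= K -> b <= K ->
  central a * central (K - a) = central b * central (K - b) ->
  a = b \/ a + b = K.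
Proof.
wlog aK : a / a <= K - a.
  move=> IH aK bK e; have [le | /ltnW ge] := leqP a (K - a); first exact: IH.
  have := IH (K - a); rewrite (subKn aK) mulnC => /(_ ge (leq_subr _ _) bK e); lia.
wlog bK : b / b <= K - b.
  move=> IH aK' bK e; have [le | /ltnW ge] := leqP b (K - b); first exact: IH.
  have := IH (K - b); rewrite (subKn bK) [in X in _ = X -> _]mulnC.
  by move=> /(_ ge aK' (leq_subr _ _) e); lia.
move=> _ _ e; left; case: (ltngtP a b) => // [ab | ba].
  have := central_convex ab bK; rewrite (_ : b - a + (K - b) = K - a) ?e ?ltnn //; lia.
have := central_convex ba aK; rewrite (_ : a - b + (K - a) = K - b) ?e ?ltnn //; lia.
Qed.

Theorem theorem1p5 (k : nat) (hk : 1 <= k) (sigma tau : 'S_k) :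
  strong_c_forest_Wilf_equivalent sigma tau ->
  sigma (Ordinal hk) = tau (Ordinal hk) \/
  (sigma (Ordinal hk)).+1 + (tau (Ordinal hk)).+1 = k + 1.
Proof.
case: k hk sigma tau => // K hk sigma tau st.
have -> : Ordinal hk = ord0 by apply: val_inj.
have := card_linked_pairs_cover sigma.
rewrite (eq_linked_pairs _ st) (card_order_type _ _ tau) -(card_linked_pairs_cover tau).
move/addnI; rewrite !card_same_root_pairs => /central_prod_inj.
(* With values counted from 0 and k = K + 1, a + b = K reads (a + 1) + (b + 1) = k + 1. *)
case; rewrite -1?ltnS ?ltn_ord //; last by right; lia.
by move=> e; left; apply: val_inj.
Qed.
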